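(* Let $a,c\in\mathbb R$ with $a^2>c^2$, $h>0$, $\varepsilon>0$, $d=i\kappa$ with $\kappa\in\mathbb R$, and suppose $\zeta(\varepsilon',d)\ne0$ for $0\le\varepsilon'\le\varepsilon$. Let $\lambda=\lambda_s(\varepsilon,d)$ be the slow root of $\varepsilon\lambda^2+\lambda+cd-\varepsilon a^2d^2=0$, and let $q=q(h,\varepsilon,d)$ be the projected amplification factor determined by $\Pi_sS_\varepsilon\Pi_s=q\,\Pi_s$. With $T_4(z)=1+z+\frac{z^2}2+\frac{z^3}6+\frac{z^4}{24}$, $$q(h,\varepsilon,d)-T_4(h\lambda)=-\frac{h^5\lambda^3(cd+\lambda)\,N}{24(1+2\varepsilon\lambda)D_8D_6},$$ where $$D_8=cd\,\varepsilon h^2-8\varepsilon^2-4\varepsilon h-h^2,\qquad D_6=cd\,\varepsilon h^2-6\varepsilon^2-6\varepsilon h-h^2,$$ and $$\begin{aligned}N={}&cd\,\varepsilon^3h^3\lambda^2-2cd\,\varepsilon^3h^2\lambda-12cd\,\varepsilon^3h-cd\,\varepsilon^2h^3\lambda-6cd\,\varepsilon^2h^2-cd\,\varepsilon h^3\\&-14\varepsilon^4h\lambda^2+16\varepsilon^4\lambda-4\varepsilon^3h^2\lambda^2+8\varepsilon^3h\lambda+8\varepsilon^2h^2\lambda+12\varepsilon^2h\\&+2\varepsilon h^3\lambda+6\varepsilon h^2+h^3.\end{aligned}$$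
   Context: Jin–Xin Fourier block: $$A=\begin{pmatrix}0&-d\\-a^2d&0\end{pmatrix},\quad B=\frac1\varepsilon\begin{pmatrix}0&0\\c&-1\end{pmatrix},\quad L_\varepsilon=A+B.$$ $\zeta(\varepsilon,d)=\sqrt{1-4\varepsilon cd+4\varepsilon^2a^2d^2}$, the branch continuous in $\varepsilon$ with $\zeta(0,d)=1$; the slow root is $$\lambda_s(\varepsilon,d)=\frac{2(\varepsilon a^2d^2-cd)}{1+\zeta(\varepsilon,d)},$$ and $1+2\varepsilon\lambda_s=\zeta$. The rank-one slow spectral projector is $$\Pi_s=\frac1\zeta\begin{pmatrix}1+\varepsilon\lambda_s&-\varepsilon d\\c-\varepsilon a^2d&\varepsilon\lambda_s\end{pmatrix}.$$ For $d\ne0$, $q=\ell_s^TS_\varepsilon r_s/(\ell_s^Tr_s)$ with $r_s=(1,-\lambda_s/d)^T$, $\ell_s^T=(-(\lambda_s+\varepsilon^{-1})/d,\,1)$. The base step is $S_\varepsilon=S(h;A,B)$ where, with $L=A+B$, $$P_*=\Bigl(I-\tfrac h2B+\tfrac{h^2}{8}BL\Bigr)^{-1}\Bigl(I+\tfrac h2A+\tfrac{h^2}{8}AL\Bigr),$$ $$S(h;A,B)=\Bigl(I-hB+\tfrac{h^2}{6}BL\Bigr)^{-1}\Bigl[I+hA+\tfrac{h^2}{6}AL+\tfrac{h^2}{3}(A-B)LP_*\Bigr].$$ *)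

(* Defs.v *)
From mathcomp Require Import all_boot all_order all_algebra.
From mathcomp Require Import all_classical all_reals all_analysis.
From mathcomp Require Import complex.

Set Implicit Arguments.
Unset Strict Implicit.
Unset Printing Implicit Defensive.

Import Order.TTheory GRing.Theory Num.Theory numFieldNormedType.Exports.

Local Open Scope classical_set_scope.
Local Open Scope ring_scope.
Local Open Scope complex_scope.

Section Scheme.
Variable K : fieldType.

Definition mx2 (x y z t : K) : 'M[K]_2 :=
  \matrix_(i, j) if i == 0 then (if j == 0 then x else y)
                 else (if j == 0 then z else t).

Definition jinxin_A (a d : K) : 'M[K]_2 := mx2 0 (- d) (- (a ^+ 2 * d)) 0.

Definition jinxin_B (c eps : K) : 'M[K]_2 := eps^-1 *: mx2 0 0 c (- 1).

(* [invmx M] is [M] itself when [M] is singular.  For the Jin-Xin block the two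
   inverted matrices have determinants [- D8 / (8 * eps ^+ 2)] and
   [- D6 / (6 * eps ^+ 2)], with [D8] and [D6] below; for [eps, h > 0], real
   [c] and imaginary [d], [D8] and [D6] have negative real part, so both
   inverses are genuine. *)
Definition stage_star (n : nat) (h : K) (A B : 'M[K]_n) : 'M[K]_n :=
  let L := A + B in
  invmx (1%:M - (h / 2) *: B + (h ^+ 2 / 8) *: (B *m L))
    *m (1%:M + (h / 2) *: A + (h ^+ 2 / 8) *: (A *m L)).

Definition base_step (n : nat) (h : K) (A B : 'M[K]_n) : 'M[K]_n :=
  let L := A + B in
  invmx (1%:M - h *: B + (h ^+ 2 / 6) *: (B *m L))
    *m (1%:M + h *: A + (h ^+ 2 / 6) *: (A *m L)
        + (h ^+ 2 / 3) *: ((A - B) *m L *m stage_star h A B)).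

(* [z] stands for the value of the branch [zeta(eps, d)]. *)
Definition slow_root (a c d eps z : K) : K :=
  2 * (eps * a ^+ 2 * d ^+ 2 - c * d) / (1 + z).

Definition slow_proj (a c d eps z : K) : 'M[K]_2 :=
  let lam := slow_root a c d eps z in
  z^-1 *: mx2 (1 + eps * lam) (- (eps * d))
              (c - eps * a ^+ 2 * d) (eps * lam).

Definition T4 (z : K) : K :=
  1 + z + z ^+ 2 / 2 + z ^+ 3 / 6 + z ^+ 4 / 24.

Definition D8 (c d eps h : K) : K :=
  c * d * eps * h ^+ 2 - 8 * eps ^+ 2 - 4 * eps * h - h ^+ 2.

Definition D6 (c d eps h : K) : K :=
  c * d * eps * h ^+ 2 - 6 * eps ^+ 2 - 6 * eps * h - h ^+ 2.

Definition defectN (c d eps h lam : K) : K :=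
  c * d * eps ^+ 3 * h ^+ 3 * lam ^+ 2
  - 2 * c * d * eps ^+ 3 * h ^+ 2 * lam
  - 12 * c * d * eps ^+ 3 * h
  - c * d * eps ^+ 2 * h ^+ 3 * lam
  - 6 * c * d * eps ^+ 2 * h ^+ 2
  - c * d * eps * h ^+ 3
  - 14 * eps ^+ 4 * h * lam ^+ 2
  + 16 * eps ^+ 4 * lam
  - 4 * eps ^+ 3 * h ^+ 2 * lam ^+ 2
  + 8 * eps ^+ 3 * h * lam
  + 8 * eps ^+ 2 * h ^+ 2 * lam
  + 12 * eps ^+ 2 * h
  + 2 * eps * h ^+ 3 * lam
  + 6 * eps * h ^+ 2
  + h ^+ 3.

End Scheme.

(* [zeta], as a function of [e] in [0, eps] at fixed frequency [d], is a
   continuous branch of the square root of [1 - 4ecd + 4e^2a^2d^2] starting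
   at 1.  It is unique on [0, eps] as soon as it does not vanish there.
   [R[i]^o] selects the modulus topology on [R[i]]. *)
Definition zeta_branch (R : realType) (a c : R) (d : R[i]) (eps : R)
    (zeta : R -> R[i]) : Prop :=
  [/\ zeta 0 = 1,
      {within `[0, eps], continuous (zeta : R -> R[i]^o)}
    & forall e : R, 0 <= e <= eps ->
        zeta e ^+ 2 = 1 - 4 * e%:C * c%:C * d
                      + 4 * e%:C ^+ 2 * a%:C ^+ 2 * d ^+ 2].

(* Main.v *)
Require Import Defs.
From mathcomp Require Import all_boot all_order all_algebra.
From mathcomp Require Import all_classical all_reals all_analysis.
From mathcomp Require Import complex.
From mathcomp Require Import ring lra.

Set Implicit Arguments.
Unset Strict Implicit.
Unset Printing Implicit Defensive.

Import Order.TTheory GRing.Theory Num.Theory numFieldNormedType.Exports.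

Local Open Scope ring_scope.
Local Open Scope complex_scope.

(** The slow projector [Pi] has trace 1 and determinant 0.  For a 2x2 matrix
    [P] of determinant 0 and any [M] one has [P M P = tr (P M) P]
    ([mx2_sandwich]), so the equation [Pi S Pi = q Pi] has exactly one solution,
    [q = tr (Pi S)] ([sandwich_factor_unique]), whether [d] is zero or not.

    This trace is a rational function of [a, c, d, eps, h, lam].  The first row
    of [B] is zero, so both implicit matrices of the scheme are lower triangular
    with diagonal [1, D/eps^2], where [D] is [- D8 / 8] for the inner stage and
    [- D6 / 6] for the outer one ([implicit_factor_inv]); hence the denominator
    of the claimed formula.  After elimination of the product [c d] by the
    slow-root equation, the formula becomes an identity of rational functions,
    decided by clearing denominators ([amplification_defect]).

    The factor [c d + lam] has a meaning: for [d <> 0] the slow eigenvector is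
    [r = (1, - lam / d)], and [B r = (0, (c d + lam) / (eps d))].  Without [B]
    the scheme is the explicit polynomial [T4 (h A)], so there is no defect when
    [B r = 0].

    Two nonvanishing facts use the hypotheses on the parameters.  As [d] is
    imaginary and [c] real, [D8] and [D6] have a negative real part.  As for
    [1 + zeta(eps)], by which the slow root is divided: if [zeta(eps) = -1], the
    real part of [zeta(eps)^2 = 1] gives [a kappa = 0], so [kappa = 0] since
    [a^2 > c^2]; then [zeta] is a continuous function on a segment with values
    in [{1, -1}] and [zeta(0) = 1], so it cannot reach [-1]
    ([connected_two_values]). *)

(** * Calculus of 2x2 matrices *)

Section Mx2.
Variable K : fieldType.
Implicit Types (x y z t k q : K) (M P : 'M[K]_2).

Lemma eq_mx2 M x y z t :
  M 0 0 = x -> M 0 1 = y -> M 1 0 = z -> M 1 1 = t -> M = mx2 x y z t.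
Proof.
move=> h00 h01 h10 h11; apply/matrixP => i j; rewrite mxE.
by case: i => [[|[|//]] i2]; case: j => [[|[|//]] j2] /=;
  [rewrite -h00|rewrite -h01|rewrite -h10|rewrite -h11]; congr (M _ _);
  apply/val_inj.
Qed.

Lemma mx2_eta M : M = mx2 (M 0 0) (M 0 1) (M 1 0) (M 1 1).
Proof. exact: eq_mx2. Qed.

Lemma mx2_scalar k : k%:M = mx2 k 0 0 k.
Proof. by apply: eq_mx2; rewrite mxE ?mulr1n ?mulr0n. Qed.

Lemma mx2D x y z t x' y' z' t' :
  mx2 x y z t + mx2 x' y' z' t' = mx2 (x + x') (y + y') (z + z') (t + t').
Proof. by apply: eq_mx2; rewrite !mxE. Qed.

Lemma mx2N x y z t : - mx2 x y z t = mx2 (- x) (- y) (- z) (- t).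
Proof. by apply: eq_mx2; rewrite !mxE. Qed.

Lemma mx2Z k x y z t : k *: mx2 x y z t = mx2 (k * x) (k * y) (k * z) (k * t).
Proof. by apply: eq_mx2; rewrite !mxE. Qed.

Lemma mx2M x y z t x' y' z' t' :
  mx2 x y z t *m mx2 x' y' z' t' =
  mx2 (x * x' + y * z') (x * y' + y * t') (z * x' + t * z') (z * y' + t * t').
Proof. by apply: eq_mx2; rewrite mxE 2!big_ord_recl big_ord0 !mxE /= addr0. Qed.

Lemma mx2_tr x y z t : \tr (mx2 x y z t) = x + t.
Proof. by rewrite /mxtrace 2!big_ord_recl big_ord0 !mxE /= addr0. Qed.

Definition mx2E := (mx2_scalar, mx2N, mx2Z, mx2M, mx2D).

Lemma invmx_mx2 x y z t : x * t - y * z != 0 ->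
  invmx (mx2 x y z t) = (x * t - y * z)^-1 *: mx2 t (- y) (- z) x.
Proof.
move=> D0; set Q := _ *: _.
have MQ : mx2 x y z t *m Q = 1%:M.
  by rewrite /Q !mx2E; congr mx2; field.
by have [Mu _] := mulmx1_unit MQ; rewrite -[LHS]mulmx1 -MQ mulKmx.
Qed.

(** A special case of [P M P = tr (P M) P - det P adj M], which is
    the Cayley-Hamilton theorem for [P M] when [M] is invertible. *)
Lemma mx2_sandwich x y z t M : x * t = y * z ->
  mx2 x y z t *m M *m mx2 x y z t = \tr (mx2 x y z t *m M) *: mx2 x y z t.
Proof.
move=> xt; rewrite [M]mx2_eta !mx2E mx2_tr.
by congr mx2; ring: xt.
Qed.

Lemma sandwich_factor_unique P M q : P != 0 ->
    P *m M *m P = \tr (P *m M) *: P ->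
  P *m M *m P = q *: P -> q = \tr (P *m M).
Proof.
move=> P0 -> /eqP; rewrite -subr_eq0 -scalerBl scaler_eq0 (negPf P0) orbF.
by rewrite subr_eq0 => /eqP.
Qed.

End Mx2.

(** * The projected amplification factor as a rational function *)

Section Amplification.
Variable K : numFieldType.
Implicit Types (a c d eps h s t z : K) (M : 'M[K]_2).

(** Both implicit matrices of the scheme have this form: [(s, t)] is
    [(h / 2, h^2 / 8)] in the inner stage and [(h, h^2 / 6)] in the outer one.
    The matrix is lower triangular because the first row of [B] is zero. *)
Lemma implicit_factor_inv a c d eps s t (A := jinxin_A a d)
    (B := jinxin_B c eps) (D := eps ^+ 2 + s * eps + t * (1 - eps * (c * d))) :
  eps != 0 -> D != 0 ->
  invmx (1%:M - s *: B + t *: (B *m (A + B))) =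
  mx2 1 0 ((s * eps * c - t * (eps * a ^+ 2 * d - c)) / D) (eps ^+ 2 / D).
Proof.
move=> eps0 D0.
have -> : 1%:M - s *: B + t *: (B *m (A + B)) =
    mx2 1 0 ((t * (eps * a ^+ 2 * d - c) - s * eps * c) / eps ^+ 2)
        (D / eps ^+ 2).
  by rewrite /A /B /jinxin_A /jinxin_B !mx2E; congr mx2; rewrite /D; field.
rewrite invmx_mx2 mul1r mul0r subr0.
  by rewrite mx2Z; congr mx2; rewrite /D; field; rewrite -/D ?D0 ?eps0.
by rewrite mulf_neq0 ?invr_eq0 ?expf_neq0.
Qed.

Lemma explicit_factor a c d eps s t (A := jinxin_A a d)
    (B := jinxin_B c eps) : eps != 0 ->
  1%:M + s *: A + t *: (A *m (A + B)) =
  mx2 (1 + t * d * (a ^+ 2 * d - c / eps)) (- s * d + t * d / eps)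
      (- s * (a ^+ 2 * d)) (1 + t * a ^+ 2 * d ^+ 2).
Proof.
by move=> eps0; rewrite /A /B /jinxin_A /jinxin_B !mx2E; congr mx2; field.
Qed.

(** The quadratic equation is solved for [c d], because in this form it
    rewrites the monomials that occur in the entries of the scheme. *)
Lemma slow_root_spec a c d eps z (lam := slow_root a c d eps z) :
    eps != 0 -> 1 + z != 0 ->
    z ^+ 2 = 1 - 4 * eps * c * d + 4 * eps ^+ 2 * a ^+ 2 * d ^+ 2 ->
  1 + 2 * eps * lam = z /\
  c * d = eps * a ^+ 2 * d ^+ 2 - eps * lam ^+ 2 - lam.
Proof.
move=> e0 z1 hz.
have zE : 1 + 2 * eps * lam = z by rewrite /lam /slow_root; field: hz.
split=> //; have lE : lam = (z - 1) / (2 * eps) by rewrite -zE; field.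
by rewrite lE; field: hz.
Qed.

Lemma slow_proj_tr a c d eps z (lam := slow_root a c d eps z) :
  z != 0 -> 1 + 2 * eps * lam = z -> \tr (slow_proj a c d eps z) = 1.
Proof.
move=> z0 zE; rewrite /slow_proj mx2Z mx2_tr -/lam -mulrDr.
have -> : 1 + eps * lam + eps * lam = z by rewrite -zE; ring.
exact: mulVf.
Qed.

Lemma slow_proj_sandwich a c d eps z M (lam := slow_root a c d eps z)
    (P := slow_proj a c d eps z) :
    c * d = eps * a ^+ 2 * d ^+ 2 - eps * lam ^+ 2 - lam ->
  P *m M *m P = \tr (P *m M) *: P.
Proof.
rewrite /P /slow_proj mx2Z -/lam => quad; apply: mx2_sandwich.
by clear P; clearbody lam; ring: quad.
Qed.

Lemma amplification_defect a c d eps h z (lam := slow_root a c d eps z) :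
    eps != 0 -> z != 0 -> D8 c d eps h != 0 -> D6 c d eps h != 0 ->
    1 + 2 * eps * lam = z ->
    c * d = eps * a ^+ 2 * d ^+ 2 - eps * lam ^+ 2 - lam ->
  \tr (slow_proj a c d eps z
       *m base_step h (jinxin_A a d) (jinxin_B c eps)) - T4 (h * lam)
  = - (h ^+ 5 * lam ^+ 3 * (c * d + lam) * defectN c d eps h lam
       / (24 * (1 + 2 * eps * lam) * D8 c d eps h * D6 c d eps h)).
Proof.
move=> e0 z0 D80 D60 zE quad; rewrite /slow_proj -/lam -zE in z0 *.
have E8 : eps ^+ 2 + h / 2 * eps + h ^+ 2 / 8 * (1 - eps * (c * d))
    = - D8 c d eps h / 8 by rewrite /D8; field.
have E6 : eps ^+ 2 + h * eps + h ^+ 2 / 6 * (1 - eps * (c * d))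
    = - D6 c d eps h / 6 by rewrite /D6; field.
have nz x n : x != 0 -> - x / n.+1%:R != 0 :> K.
  by move=> x0; rewrite mulf_neq0 ?oppr_eq0 ?invr_eq0 ?pnatr_eq0.
rewrite /base_step /stage_star !explicit_factor //.
rewrite !implicit_factor_inv // ?E8 ?E6 ?nz //.
rewrite /jinxin_A /jinxin_B !mx2E mx2_tr.
clear zE; clearbody lam; rewrite /T4 /defectN /D8 /D6 in D80 D60 *.
by field: quad; rewrite D60 D80 z0 e0.
Qed.

End Amplification.

(** * Nonvanishing of the denominators *)

(** If both values were taken, they would disconnect the image of the segment,
    since each of them is a closed set. *)
Lemma connected_two_values (R : realType) (T : topologicalType) (a b : R)
    (f : R -> T) (x y : T) :
    accessible_space T -> {within `[a, b], continuous f}%classic ->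
    (forall e, a <= e <= b -> f e = x \/ f e = y) ->
  a <= b -> f a = x -> f b = x.
Proof.
move=> T1 fc fxy ab fa; case: (pselect (x = y)) => [xy|xy].
  by have /fxy[//|->] : a <= b <= b by rewrite ab lexx.
have /(_ [set x]%classic) imf_eq :=
  connected_continuous_connected (@segment_connected R a b) fc.
have xin : (f @` `[a, b])%classic x.
  by exists a; rewrite //= in_itv /= lexx ab.
have bin : (f @` `[a, b])%classic (f b).
  by exists b; rewrite //= in_itv /= lexx ab.
suff: [set x]%classic (f b) by [].
rewrite imf_eq //.
- by exists x.
- exists (~` [set y])%classic; first exact/closed_openC/accessible_closed_set1.
  apply/seteqP; split=> [_ ->//|_ [[e /= + <-]]].
  by rewrite in_itv /= => /fxy [->|->].
- exists [set x]%classic; first exact: accessible_closed_set1.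
  by apply/seteqP; split=> [z ->|z []].
Qed.

Lemma real_imag_comb_neq0 (R : rcfType) (x y k : R) : x < 0 ->
  x%:C + y%:C * (0 +i* k) != 0.
Proof.
move=> x0; apply/eqP => /(congr1 (@complex.Re R)) /=.
by rewrite mulr0 mul0r subr0 addr0 => x0'; rewrite x0' ltxx in x0.
Qed.

Lemma D8_neq0 (R : rcfType) (c eps h k : R) : 0 < h -> 0 < eps ->
  D8 c%:C (0 +i* k) eps%:C h%:C != 0.
Proof.
move=> h0 e0; rewrite [D8 _ _ _ _](_ : _ =
    (- (8 * eps ^+ 2 + 4 * eps * h + h ^+ 2))%:C
    + (c * eps * h ^+ 2)%:C * (0 +i* k)); last by rewrite /D8; ring.
by rewrite real_imag_comb_neq0 // oppr_lt0; nra.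
Qed.

Lemma D6_neq0 (R : rcfType) (c eps h k : R) : 0 < h -> 0 < eps ->
  D6 c%:C (0 +i* k) eps%:C h%:C != 0.
Proof.
move=> h0 e0; rewrite [D6 _ _ _ _](_ : _ =
    (- (6 * eps ^+ 2 + 6 * eps * h + h ^+ 2))%:C
    + (c * eps * h ^+ 2)%:C * (0 +i* k)); last by rewrite /D6; ring.
by rewrite real_imag_comb_neq0 // oppr_lt0; nra.
Qed.

Lemma zeta_branch_neqN1 (R : realType) (a c eps k : R) (zeta : R -> R[i]) :
    c ^+ 2 < a ^+ 2 -> 0 < eps -> zeta_branch a c (0 +i* k) eps zeta ->
  1 + zeta eps != 0.
Proof.
move=> hac eps_gt0 [z0 zc zsq].
apply/eqP => /eqP; rewrite addrC addr_eq0 => /eqP zN1.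
have [k0|k0] := eqVneq k 0.
  have d0 : 0 +i* k = 0 :> R[i] by rewrite k0.
  have z_pm1 (e : R) : 0 <= e <= eps -> zeta e = 1 \/ zeta e = -1.
    move=> /zsq; rewrite d0 expr0n !mulr0 subr0 addr0 => /eqP.
    by rewrite sqrf_eq1 => /orP[] /eqP; [left|right].
  have := @connected_two_values R (R[i]^o : topologicalType) 0 eps zeta 1 (-1)
    (hausdorff_accessible (@norm_hausdorff _ _)) zc z_pm1 (ltW eps_gt0) z0.
  rewrite zN1 => /eqP; rewrite eq_sym -addr_eq0 => /eqP h11.
  by have := pnatr_eq0 R[i] 2; rewrite -[2%:R]/(1 + 1) h11 eqxx.
have /eqP[] : (- (4 * eps ^+ 2 * a ^+ 2 * k ^+ 2))%:C
    + (- 4 * eps * c)%:C * (0 +i* k) != 0.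
  have a2 : 0 < a ^+ 2 by exact: le_lt_trans (sqr_ge0 c) hac.
  have k2 : 0 < k ^+ 2 by rewrite exprn_even_gt0.
  have e2 : 0 < 4 * eps ^+ 2 by rewrite pmulr_rgt0 ?exprn_gt0.
  apply: real_imag_comb_neq0.
  by rewrite oppr_lt0 (mulr_gt0 (mulr_gt0 e2 a2) k2).
have dsq : (0 +i* k) ^+ 2 = - (k ^+ 2)%:C.
  rewrite expr2; apply/eqP.
  by rewrite eq_complex /= !mul0r !mulr0 sub0r addr0 oppr0 -expr2 !eqxx.
have /zsq sq1 : 0 <= eps <= eps by rewrite lexx ltW.
rewrite zN1 sqrrN expr1n dsq in sq1.
by apply: (addrI 1); rewrite addr0; apply: etrans (esym sq1); ring.
Qed.

(** * The defect of the slow amplification factor *)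

Theorem lemma5p3 (R : realType) (a c h eps kappa : R) (d : R[i])
    (zeta : R -> R[i])
    (hac : c ^+ 2 < a ^+ 2) (h_gt0 : 0 < h) (eps_gt0 : 0 < eps)
    (hd : d = 0 +i* kappa)
    (hzeta : zeta_branch a c d eps zeta)
    (zeta_neq0 : forall e : R, 0 <= e <= eps -> zeta e != 0) :
  let lam := slow_root a%:C c%:C d eps%:C (zeta eps) in
  let Pi := slow_proj a%:C c%:C d eps%:C (zeta eps) in
  let Seps := base_step h%:C (jinxin_A a%:C d) (jinxin_B c%:C eps%:C) in
  (exists! q : R[i], Pi *m Seps *m Pi = q *: Pi) /\
  forall q : R[i], Pi *m Seps *m Pi = q *: Pi ->
    q - T4 (h%:C * lam)
    = - (h%:C ^+ 5 * lam ^+ 3 * (c%:C * d + lam)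
         * defectN c%:C d eps%:C h%:C lam
         / (24 * (1 + 2 * eps%:C * lam)
            * D8 c%:C d eps%:C h%:C * D6 c%:C d eps%:C h%:C)).
Proof.
move=> lam Pi Seps; subst d.
have eps0 : eps%:C != 0 by rewrite fmorph_eq0 gt_eqF.
have in_eps : 0 <= eps <= eps by rewrite lexx ltW.
have z0 : zeta eps != 0 by exact: zeta_neq0.
have z1 : 1 + zeta eps != 0 by exact: zeta_branch_neqN1 hac eps_gt0 hzeta.
case: hzeta => _ _ /(_ eps in_eps) zsq.
have [zE quad] := slow_root_spec eps0 z1 zsq.
have Pi_neq0 : Pi != 0.
  apply: contraTneq (oner_neq0 R[i]) => P0.
  by rewrite -(slow_proj_tr z0 zE) -/Pi P0 mxtrace0 eqxx.
have sandwich : Pi *m Seps *m Pi = \tr (Pi *m Seps) *: Pi.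
  exact: slow_proj_sandwich.
have factorE q : Pi *m Seps *m Pi = q *: Pi -> q = \tr (Pi *m Seps).
  exact: sandwich_factor_unique.
split; first by exists (\tr (Pi *m Seps)); split=> // q /factorE.
by move=> q /factorE ->; apply: amplification_defect; rewrite ?D8_neq0 ?D6_neq0.
Qed.
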